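(* The number of $(k,3)$-right-crucial permutations of length $n=k$ is $k-1$, and for $n\ge k+1$ and $k\ge3$, the number of $(k,3)$-right-crucial permutations of length $n$ is given by $$s^{(c)}_n(k,3)=\frac{(2k-n)(2k-n-1)}{(n-k)(n-k+1)}\binom{n-1}{k}\binom{n}{k}.$$ Moreover, for $2\le i\le k-1$, the number of $(k,3)$-right-crucial permutations of $i$-th smallest length $k+i-1$ is given by $$\frac{(k-i)(k-i+1)}{i(i-1)}\binom{k+i-2}{k}\binom{k+i-1}{k},$$ and this number (of $(k,3)$-right-crucial permutations of length $k+i-1$) is $0$ for $i\ge k$. By symmetry, replacing $k$ by $\ell$ in the formulas gives the results for $(3,\ell)$-crucial permutations for $\ell\ge3$.
   Context: $i_m=12\cdots m$ and $d_m=m(m-1)\cdots 1$; a permutation (in one-line notation) contains $i_m$ (resp. $d_m$) if it has an increasing (resp. decreasing) subsequence of length $m$, and avoids it otherwise. The extensions of a permutation $\sigma=\sigma_1\cdots\sigma_n$ of $\{1,\ldots,n\}$ to the right are the permutations $e_t(\sigma_1)\cdots e_t(\sigma_n)\,t$ of $\{1,\ldots,n+1\}$, $1\le t\le n+1$, where $e_t(x)=x$ if $x<t$ and $e_t(x)=x+1$ if $x\ge t$. A permutation is $(k,\ell)$-right-crucial (also called $(k,\ell)$-crucial) if it avoids $i_k$ and $d_\ell$ but each of its extensions to the right contains $i_k$ or $d_\ell$. $s^{(c)}_n(k,\ell)$ denotes the number of $(k,\ell)$-right-crucial permutations of length $n$.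
   Formalization: The formula for n ≥ k+1 is stated only for k+1 ≤ n ≤ 2k (likewise n ≤ 2ℓ): for n ≥ 2k+1 it gives a positive value (70 at k=3, n=7) although no such permutations exist; those lengths are covered by the clause with value 0. *)

(* Defs.v *)
From mathcomp Require Import all_boot all_order all_algebra all_fingroup.

Set Implicit Arguments.
Unset Strict Implicit.
Unset Printing Implicit Defensive.

(* A permutation of length n is s : 'S_n, with positions and values both
   numbered from 0; its one-line notation is s 0, ..., s (n - 1). A
   subsequence of it is given by the set A of the positions it uses. *)

Definition contains_inc (n m : nat) (s : 'S_n) : bool :=
  [exists A : {set 'I_n},
     (#|A| == m) && [forall i in A, forall j in A, (i < j) ==> (s i < s j)]].

Definition contains_dec (n m : nat) (s : 'S_n) : bool :=
  [exists A : {set 'I_n},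
     (#|A| == m) && [forall i in A, forall j in A, (i < j) ==> (s j < s i)]].

(* [lift_perm ord_max t s] sends the last position to t and every earlier
   position i to bump t (s i), which is s i if s i < t and (s i).+1 if
   t <= s i. *)
Definition right_extension (n : nat) (s : 'S_n) (t : 'I_n.+1) : 'S_n.+1 :=
  lift_perm ord_max t s.

Definition right_crucial (k l n : nat) (s : 'S_n) : bool :=
  [&& ~~ contains_inc k s, ~~ contains_dec l s &
      [forall t : 'I_n.+1, contains_inc k (right_extension s t)
                           || contains_dec l (right_extension s t)]].

Definition num_right_crucial (n k l : nat) : nat :=
  #|[set s : 'S_n | right_crucial k l s]|.

(* With i counted from 1: n is a length of (k, l)-right-crucial permutations
   and exactly i - 1 smaller lengths are. *)
Definition ith_smallest_length (k l i n : nat) : Prop :=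
  0 < num_right_crucial n k l /\
  (count (fun m => 0 < num_right_crucial m k l) (iota 0 n)).+1 = i.

(* Main.v *)
Require Import Defs.
From mathcomp Require Import all_boot all_order all_algebra all_fingroup.
From mathcomp Require Import zify ring.
Import GRing.Theory.

(** The proof is Schensted's correspondence for tableaux with at most two rows,
    reduced to the part that counting needs.

    Read a permutation from left to right. The first row of its insertion
    tableau is recorded by a boolean word indexed by the values, [first_row]: a
    value has letter [true] if it lies in that row. Appending a last entry [t]
    inserts a [true] at position [t] and turns the next [true] into [false],
    since the corresponding value is bumped ([row_insert]). The number of
    [true]s among the values below [r] is the length of a longest increasing
    subsequence with values below [r] ([inc_belowE]). When [d_3] is avoided, the
    [false]s form the second row, and the values from [r] on contain no
    decreasing pair exactly when the suffix of the word at [r] has the form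
    0...01...1 ([dec_aboveE]).

    This turns the crucial property into a condition on the word. For p > 0 and
    a permutation avoiding [i_(p+1)] and [d_3], the extension by [t] avoids them
    as well iff fewer than [p] letters before position [t] are [true] and the
    suffix at [t] has the form 0...01...1. The largest [t] rules this out only
    if the word has exactly [p] letters [true]; then [t] must be at or before
    the last [true], whose suffix has the required form only if no [false]
    follows. So the permutation is crucial iff its word has [p] letters [true]
    and ends with [false] ([right_crucialE]): its tableau has a first row of
    length k - 1, and its largest value lies in the second row.

    It remains to count. Undoing an insertion removes one of the two corners of
    the tableau, so the number of permutations with a given ballot word obeys
    the recurrence of the number [syt2 p q] of standard tableaux of shape
    (p, q), and depends on the shape only ([num_av321_with_rowE]). The ballot
    words are themselves the tableaux, and those of shape (p, q) that end with
    [false] are those of shape (p, q - 1) with a letter appended. So the number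
    of (k, 3)-crucial permutations of length k + q is
    [syt2 k.-1 q * syt2 k.-1 q.+1] ([num_right_crucialS]), and the closed form
    of [syt2] gives the formulas. Complementing the values exchanges increasing
    and decreasing subsequences, which settles the (3, l) case. *)

Set Implicit Arguments.
Unset Strict Implicit.
Unset Printing Implicit Defensive.
Local Open Scope nat_scope.

(** * Building permutations by right extensions *)

Lemma lift_perm_bij n :
  bijective (fun ts : 'I_n.+1 * 'S_n => lift_perm ord_max ts.1 ts.2).
Proof.
apply: inj_card_bij; last by rewrite card_prod card_ord !card_Sn factS.
move=> [t s] [t' s'] /= /permP E; have Et := E ord_max.
rewrite !lift_perm_id in Et; congr (_, _) => //; apply/permP => i.
by apply: (@lift_inj _ t); have := E (lift ord_max i); rewrite !lift_perm_lift Et.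
Qed.

Lemma card_perm_recr n (P : pred 'S_n.+1) :
  #|[set s | P s]| = \sum_(t < n.+1) #|[set s : 'S_n | P (right_extension s t)]|.
Proof.
under eq_bigr do rewrite -sum1dep_card.
rewrite -sum1dep_card pair_big_dep /= (reindex _ (onW_bij _ (lift_perm_bij n))).
by apply: eq_bigl => -[].
Qed.

(** The relabelling of the remaining values is left implicit: the result is
    characterized as the unique permutation that has [s] as an extension. *)
Definition delete_last n (s : 'S_n.+1) : 'S_n :=
  odflt 1%g [pick s0 | right_extension s0 (s ord_max) == s].

Lemma right_extensionK n (s : 'S_n) t : delete_last (right_extension s t) = s.
Proof.
rewrite /delete_last; case: pickP => [s0 /eqP|/(_ s)];
  rewrite {1}/right_extension lift_perm_id ?eqxx //= => E.
by case: (bij_inj (@lift_perm_bij n) (E : _ (_, _) = _ (_, _))).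
Qed.

Lemma perm_extension n (s : 'S_n.+1) :
  exists t s0, s = right_extension s0 t.
Proof.
case: (lift_perm_bij n) => g _ gK; exists (g s).1, (g s).2.
by rewrite -{1}(gK s).
Qed.

(** The bound on the values makes [contains_inc] inductive: an increasing
    subsequence that ends with a new last entry [t] continues one with values
    below [t]. *)
Definition inc_below m r n (s : 'S_n) : bool :=
  [exists A : {set 'I_n}, [&& #|A| == m, [forall i in A, s i < r] &
     [forall i in A, forall j in A, (i < j) ==> (s i < s j)]]].

Lemma inc_belowP m r n (s : 'S_n) :
  reflect (exists A : {set 'I_n}, [/\ #|A| = m, {in A, forall i, s i < r} &
             {in A &, forall i j : 'I_n, i < j -> s i < s j}])
          (inc_below m r s).
Proof.
apply: (iffP existsP) => -[A].
  case/and3P=> /eqP cA /forall_inP bA /forall_inP iA; exists A; split=> // i j Ai Aj.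
  by have /forall_inP/(_ j Aj)/implyP := iA i Ai.
case=> cA bA iA; exists A; rewrite cA eqxx /=; apply/andP; split; first exact/forall_inP.
by apply/forall_inP => i Ai; apply/forall_inP=> j Aj; apply/implyP; apply: iA.
Qed.

Lemma contains_incE n (s : 'S_n) m : contains_inc m s = inc_below m n s.
Proof.
apply: eq_existsb => A; congr (_ && _); rewrite [X in _ = X && _](_ : _ = true) //.
by apply/forall_inP => i _; apply: ltn_ord.
Qed.

Lemma inc_below0 r n (s : 'S_n) : inc_below 0 r s.
Proof. by apply/inc_belowP; exists set0; split=> [|i|i j]; rewrite ?cards0 ?inE. Qed.

Lemma inc_below_nil m r (s : 'S_0) : inc_below m r s = (m == 0).
Proof.
case: m => [|m]; first exact: inc_below0.
by apply/inc_belowP => -[A [cA _ _]]; have := max_card A; rewrite cA card_ord.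
Qed.

(** An increasing subsequence of the extension either avoids the last entry, in
    which case the bound [r] only has to be translated through the relabelling
    [bump t], or uses it as its largest value. *)
Lemma inc_below_ext m r n (s : 'S_n) (t : 'I_n.+1) :
  inc_below m r (right_extension s t) =
  inc_below m (if r <= t then r else r.-1) s
  || [&& 0 < m, t < r & inc_below m.-1 t s].
Proof.
set e := right_extension s t.
have eL : e ord_max = t by exact: lift_perm_id.
have el i : e (lift ord_max i) = bump t (s i) :> nat by rewrite /e /right_extension lift_perm_lift.
have vl (i : 'I_n) : lift ord_max i = i :> nat by exact: lift_max.
have bumpr v : (bump t v < r) = (v < if r <= t then r else r.-1).
  by rewrite /bump; case: (leqP t v); case: (leqP r t); lia.
apply/idP/idP.
  case/inc_belowP => A [cA bA iA].
  pose B := [set i | lift ord_max i \in A].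
  have iB : {in B &, forall i j : 'I_n, i < j -> s i < s j}.
    move=> i j; rewrite !inE => Ai Aj ij.
    have := iA _ _ Ai Aj; rewrite !vl !el => /(_ ij).
    by rewrite /bump; case: (leqP t (s i)); case: (leqP t (s j)); lia.
  have imB : A :\ ord_max = [set lift ord_max i | i in B].
    apply/setP=> i; rewrite !inE; apply/andP/imsetP => [[iL Ai]|[j]].
      case: (unliftP ord_max i) => [j ij|ij]; last by rewrite ij eqxx in iL.
      by exists j; rewrite // inE -ij.
    by rewrite inE => Aj ->; rewrite eq_sym neq_lift.
  have cB : #|A :\ ord_max| = #|B| by rewrite imB card_imset //; exact: lift_inj.
  have := cardsD1 ord_max A; rewrite cA cB; case: (boolP (ord_max \in A)) => [AL|AL] cm.
    apply/orP; right; rewrite cm /= -{1}eL (bA _ AL) /=; apply/inc_belowP; exists B; split=> // i.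
    rewrite inE => Ai; have := iA _ _ Ai AL; rewrite vl eL el /= ltn_ord => /(_ isT).
    by rewrite /bump; case: (leqP t (s i)); lia.
  apply/orP; left; apply/inc_belowP; exists B; split=> // i; rewrite inE => Ai.
  by rewrite -bumpr -el; apply: bA.
have main (B : {set 'I_n}) (b : bool) :
  {in B, forall i, s i < if r <= t then r else r.-1} ->
  {in B &, forall i j : 'I_n, i < j -> s i < s j} ->
  (b -> t < r /\ {in B, forall i, s i < t}) -> inc_below (b + #|B|) r e.
  move=> bB iB hb; apply/inc_belowP.
  pose B' := [set lift ord_max i | i in B].
  have nL : ord_max \notin B'.
    by apply/imsetP => -[i _ /eqP]; rewrite (negbTE (neq_lift _ _)).
  have cB' : #|B'| = #|B| by rewrite card_imset //; exact: lift_inj.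
  have bB' : {in B', forall i, e i < r}.
    by move=> _ /imsetP[i Bi ->]; rewrite el bumpr; apply: bB.
  have iB' : {in B' &, forall i j : 'I_n.+1, i < j -> e i < e j}.
    move=> _ _ /imsetP[i Bi ->] /imsetP[j Bj ->]; rewrite !vl !el => /(iB _ _ Bi Bj).
    by rewrite /bump; case: (leqP t (s i)); case: (leqP t (s j)); lia.
  case: b hb => [[//|tr tB]|_]; last by exists B'; split.
  exists (ord_max |: B'); split=> [|i|i j].
  - by rewrite cardsU1 nL cB'.
  - by case/setU1P=> [->|/bB' //]; rewrite eL.
  - case/setU1P=> [->|Bi] /setU1P[->|Bj]; rewrite ?ltnn //; last exact: iB'.
      by move=> /= lj; have := ltn_ord j; lia.
    case/imsetP: Bi => k Bk ->; rewrite eL el => _.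
    by have := tB _ Bk; rewrite /bump; case: (leqP t (s k)); lia.
case/orP=> [/inc_belowP[B [<- bB iB]]|/and3P[m0 tr /inc_belowP[B [cB bB iB]]]].
  exact: (main B false).
rewrite -(prednK m0) -cB; apply: (main B true) => // i Bi.
by have := bB _ Bi; case: (leqP r t); lia.
Qed.

(** * Complementing the values *)

Definition complement n (s : 'S_n) : 'S_n := (s * perm (@rev_ord_inj n))%g.

Lemma complementE n (s : 'S_n) i : complement s i = rev_ord (s i).
Proof. by rewrite permM permE. Qed.

Lemma complementK n : involutive (@complement n).
Proof. by move=> s; apply/permP=> i; rewrite !complementE rev_ordK. Qed.

Lemma complement_ext n (s : 'S_n) t :
  complement (right_extension s t) = right_extension (complement s) (rev_ord t).
Proof.
apply/permP=> i; rewrite complementE /right_extension.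
case: (unliftP ord_max i) => [j ->|->]; rewrite ?lift_perm_id // !lift_perm_lift.
apply/val_inj; rewrite complementE /= /bump.
have := ltn_ord t; have := ltn_ord (s j).
by case: (leqP t (s j)) => /=; lia.
Qed.

Lemma contains_dec_complement n (s : 'S_n) m :
  contains_dec m (complement s) = contains_inc m s.
Proof.
apply: eq_existsb => A; congr (_ && _).
apply: eq_forallb_in => i _; apply: eq_forallb_in => j _.
by congr (_ ==> _); rewrite !complementE /=; have := ltn_ord (s i); have := ltn_ord (s j); lia.
Qed.

Lemma contains_inc_complement n (s : 'S_n) m :
  contains_inc m (complement s) = contains_dec m s.
Proof. by rewrite -contains_dec_complement complementK. Qed.

Lemma right_crucial_complement k l n (s : 'S_n) :
  right_crucial k l (complement s) = right_crucial l k s.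
Proof.
rewrite /right_crucial contains_dec_complement contains_inc_complement andbCA.
congr [&& _, _ & _]; apply/forallP/forallP => H t; have := H (rev_ord t).
  by rewrite orbC -complement_ext contains_dec_complement contains_inc_complement.
rewrite orbC -[t in X in _ -> X]rev_ordK -complement_ext.
by rewrite contains_dec_complement contains_inc_complement.
Qed.

Lemma num_right_crucialC n k l : num_right_crucial n k l = num_right_crucial n l k.
Proof.
rewrite /num_right_crucial -(card_imset _ (inv_inj (@complementK n))).
apply: eq_card => s; rewrite !inE -right_crucial_complement.
by rewrite -{1}[s]complementK (mem_imset _ _ (inv_inj (@complementK n))) inE.
Qed.

(** * The first row of the insertion tableau *)

Fixpoint bump_first (w : bitseq) : bitseq :=
  match w with
  | [::] => [::]
  | true :: w' => false :: w'
  | false :: w' => false :: bump_first w'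
  end.

(** Schensted row insertion: the new value [t] enters the first row and the
    next value of that row is bumped out of it. *)
Definition row_insert (t : nat) (w : bitseq) : bitseq :=
  take t w ++ true :: bump_first (drop t w).

Fixpoint first_row n : 'S_n -> bitseq :=
  match n with
  | 0 => fun=> [::]
  | n'.+1 => fun s => row_insert (s ord_max) (first_row (delete_last s))
  end.

Lemma first_row_ext n (s : 'S_n) (t : 'I_n.+1) :
  first_row (right_extension s t) = row_insert t (first_row s).
Proof. by rewrite /= right_extensionK /right_extension lift_perm_id. Qed.

Lemma size_bump_first w : size (bump_first w) = size w.
Proof. by elim: w => [|[] w IH] //=; rewrite IH. Qed.

Lemma size_insert t w : size (row_insert t w) = (size w).+1.
Proof. by rewrite size_cat /= size_bump_first addnS -size_cat cat_take_drop. Qed.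

Lemma size_first_row n (s : 'S_n) : size (first_row s) = n.
Proof. by elim: n s => //= n IH s; rewrite size_insert IH. Qed.

Lemma insert_cat u v : row_insert (size u) (u ++ v) = u ++ true :: bump_first v.
Proof. by rewrite /row_insert take_size_cat // drop_size_cat. Qed.

Lemma cut_at t (w : bitseq) : t <= size w -> exists u v, w = u ++ v /\ size u = t.
Proof.
by move=> tw; exists (take t w), (drop t w); rewrite cat_take_drop size_takel.
Qed.

(** Bumping loses one [true] from the moment the first one has been read; the
    form with [maxn] avoids distinguishing whether it has. *)
Lemma count_take_bump_first r w :
  (count id (take r (bump_first w))).+1 = maxn (count id (take r w)) 1.
Proof. by elim: w r => [|[] w IH] [|r] //=; have := IH r; lia. Qed.

Lemma count_take_insert t r w : t <= size w ->
  count id (take r (row_insert t w)) =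
  if r <= t then count id (take r w)
  else maxn (count id (take r.-1 w)) (count id (take t w)).+1.
Proof.
case/cut_at=> u [v [-> <-]]; rewrite insert_cat !take_cat ltnn subnn take0 cats0.
case: (ltngtP r (size u)) => [ru|ur|->] //; last by rewrite subnn !take0.
have -> : r - size u = (r.-1 - size u).+1 by lia.
rewrite ltnNge (_ : _ <= r.-1) /=; last by lia.
by rewrite !count_cat /=; have := count_take_bump_first (r.-1 - size u) v; lia.
Qed.

(** Schensted's theorem on longest increasing subsequences: the recursions of
    both sides under right extension, [inc_below_ext] and [count_take_insert],
    are the same. *)
Lemma inc_belowE n (s : 'S_n) m r : r <= n ->
  inc_below m r s = (m <= count id (take r (first_row s))).
Proof.
elim: n s m r => [|n IH] s m r rn.
  by rewrite inc_below_nil; case: m.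
have [t [s0 ->]] := perm_extension s.
have tn : t <= n by rewrite -ltnS.
rewrite first_row_ext inc_below_ext count_take_insert ?size_first_row //.
case: (leqP r t) => rt; first by rewrite andbF orbF IH //; lia.
by rewrite IH; [case: m => [|m] /=; rewrite ?IH //; lia | lia].
Qed.

Lemma contains_inc_first_row n (s : 'S_n) m :
  contains_inc m s = (m <= count id (first_row s)).
Proof. by rewrite contains_incE inc_belowE // -{1}(size_first_row s) take_size. Qed.

Lemma inc_below1 n (s : 'S_n) r : r <= n -> inc_below 1 r s = (0 < r).
Proof.
elim: n s r => [|n IH] s r rn; first by rewrite inc_below_nil; case: r rn.
have [t [s0 ->]] := perm_extension s.
have tn : t <= n by rewrite -ltnS.
rewrite inc_below_ext inc_below0 andbT; case: (leqP r t) => rt.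
  by rewrite orbF IH //; lia.
by rewrite orbT; lia.
Qed.

(** * Decreasing pairs and suffixes of the first row *)

(** The order [implb] puts [false] before [true], so the sorted words are
    those of the form 0...01...1. *)
Notation two_runs := (sorted implb).

Lemma two_runs_cons w : two_runs (true :: w) = all id w.
Proof. by elim: w => [|[] w IH] //=; rewrite -IH. Qed.

Lemma two_runs_cons0 w : two_runs (false :: w) = two_runs w.
Proof. by case: w. Qed.

Lemma two_runs_rcons w : two_runs (rcons w true) = two_runs w.
Proof. by case: w => //= b w; rewrite rcons_path implybT andbT. Qed.

Lemma two_runs_nseq a b : two_runs (nseq a false ++ nseq b true).
Proof.
elim: a => [|a IH]; last by rewrite two_runs_cons0.
by case: b => // b; rewrite two_runs_cons all_nseq orbT.
Qed.

Lemma two_runsP w :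
  reflect (exists a b, w = nseq a false ++ nseq b true) (two_runs w).
Proof.
apply: (iffP idP) => [|[a [b ->]]]; last exact: two_runs_nseq.
elim: w => [_|[] w IH]; first by exists 0, 0.
  rewrite two_runs_cons (eq_all (a2 := pred1 true)) => [/all_pred1P E|[]//].
  by exists 0, (size w).+1; rewrite /= -E.
by rewrite two_runs_cons0 => /IH[a [b ->]]; exists a.+1, b.
Qed.

Lemma bump_first_nseq a b :
  bump_first (nseq a false ++ nseq b true) =
  nseq (a + (0 < b)) false ++ nseq b.-1 true.
Proof. by elim: a => [|a IH] /=; [case: b | rewrite IH]. Qed.

Lemma two_runs_bump w : two_runs w -> two_runs (bump_first w).
Proof. by case/two_runsP=> a [b ->]; rewrite bump_first_nseq two_runs_nseq. Qed.

Lemma two_runs_drop i w : two_runs w -> two_runs (drop i w).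
Proof. by rewrite -{1}(cat_take_drop i w) => /cat_sorted2[]. Qed.

(** Seen from [r <= t], an insertion before a nonempty 0...01...1 suffix leaves
    the new [true] in front of a [false], as the suffix then begins with
    [false]: either it did so before, or its first [true] has been bumped. Seen
    from the right of [t], bumping only lengthens the run of [false]s. *)
Lemma two_runs_drop_insert t r w : t <= size w -> two_runs (drop t w) ->
  two_runs (drop r (row_insert t w)) =
  if r <= t then (t == size w) && two_runs (drop r w) else true.
Proof.
case/cut_at=> u [v [-> <-]]; rewrite drop_size_cat // insert_cat !drop_cat size_cat => v2.
case: (ltngtP r (size u)) => [ru|ur|->].
- case: v v2 => [|b v] _; first by rewrite addn0 eqxx cats0 cats1 two_runs_rcons.
  rewrite (_ : (_ == _) = false) /=; last by lia.
  by apply/negP => /cat_sorted2[_]; case: b.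
- have -> : r - size u = (r.-1 - size u).+1 by lia.
  by rewrite [drop _ _]/=; apply: two_runs_drop; apply: two_runs_bump.
- rewrite subnn !drop0 two_runs_cons v2 andbT.
  by case: v v2 => [|[] v] //= _; lia.
Qed.

(** The last entry [t] completes a decreasing triple when a decreasing pair has
    both values at least [t], that is, when the complement has an increasing
    pair with values below [n - t]. *)
Lemma contains_dec3_ext n (s : 'S_n) (t : 'I_n.+1) :
  contains_dec 3 (right_extension s t) =
  contains_dec 3 s || inc_below 2 (n - t) (complement s).
Proof.
rewrite -!contains_inc_complement complement_ext !contains_incE inc_below_ext.
by rewrite ltnNge ltn_ord -ltnS ltn_ord /= subSS.
Qed.

(** Avoiding [d_3] is what allows the induction: every insertion then takes
    place before a suffix of the form 0...01...1. *)
Lemma dec_aboveE n (s : 'S_n) r : ~~ contains_dec 3 s -> r <= n ->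
  inc_below 2 (n - r) (complement s) = ~~ two_runs (drop r (first_row s)).
Proof.
elim: n s r => [|n IH] s r; first by rewrite inc_below_nil; case: r.
have [t [s0 ->]] := perm_extension s; have tn : t <= n by rewrite -ltnS.
rewrite contains_dec3_ext negb_or => /andP[s3]; rewrite IH // negbK => dt rn.
rewrite first_row_ext two_runs_drop_insert ?size_first_row //.
rewrite complement_ext inc_below_ext /= subSS inc_below1 ?leq_subr // subn_gt0.
case: (leqP r t) => rt.
  have -> : (n.+1 - r <= n - t) = false by lia.
  have -> : (n.+1 - r).-1 = n - r by lia.
  rewrite IH //; last by lia.
  by case: eqP => [->|] /=; [rewrite ltnn andbF orbF | lia].
have -> : n.+1 - r <= n - t by lia.
have -> : n.+1 - r = n - r.-1 by lia.
rewrite IH //; last by lia.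
rewrite (_ : n - t < n - r.-1 = false) ?andbF ?orbF; last by lia.
have -> : drop r.-1 (first_row s0) = drop (r.-1 - t) (drop t (first_row s0)).
  by rewrite drop_drop subnK //; lia.
by rewrite two_runs_drop.
Qed.

Definition av321 n (s : 'S_n) : bool := ~~ contains_dec 3 s.

Lemma av321_ext n (s : 'S_n) (t : 'I_n.+1) :
  av321 (right_extension s t) = av321 s && two_runs (drop t (first_row s)).
Proof.
have tn : t <= n by rewrite -ltnS.
rewrite /av321 contains_dec3_ext negb_or; case s3 : (contains_dec 3 s) => //=.
by rewrite dec_aboveE ?s3 ?negbK.
Qed.

(** * Crucial permutations in terms of the first row *)

Lemma right_crucialE n (s : 'S_n) p : 0 < p ->
  right_crucial p.+1 3 s =
  [&& av321 s, count id (first_row s) == p & ~~ last true (first_row s)].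
Proof.
move=> p0; rewrite /right_crucial contains_inc_first_row -/(av321 s) -leqNgt.
case s3: (av321 s); rewrite ?andbF //=.
have extE (t : 'I_n.+1) :
  contains_inc p.+1 (right_extension s t) || contains_dec 3 (right_extension s t)
  = [|| p.+1 <= count id (first_row s), p <= count id (take t (first_row s))
      | ~~ two_runs (drop t (first_row s))].
  have tn : t <= n by rewrite -ltnS.
  rewrite contains_incE inc_below_ext ltnNge ltn_ord /= -ltnS ltn_ord /=.
  rewrite -contains_incE contains_inc_first_row inc_belowE // orbA; congr (_ || _).
  by rewrite contains_dec3_ext dec_aboveE // (negbTE s3).
apply/andP/andP => [[cp /forallP H]|[/eqP cp Hl]]; last first.
  rewrite cp leqnn; split=> //; apply/forallP => t; rewrite extE cp ltnn /=.
  (* Some [true] lies at or after t, so a suffix 0...01...1 would end with it. *)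
  case: leqP => //= ct; apply: contraNN Hl => /two_runsP[a [b E]].
  have := cp; rewrite -(cat_take_drop t (first_row s)) E last_cat last_cat !count_cat.
  by rewrite !count_nseq /= mul0n mul1n; case: b {E} => [|b] h; [lia | by elim: b {h}].
(* The largest value forces p letters [true]; the position of a final [true]
   would then be a harmless extension. *)
have := H ord_max; rewrite extE /= ltnNge cp /= -[n in take n](size_first_row s) take_size.
rewrite -[n in drop n](size_first_row s) drop_size orbF => pc.
have {pc} cp' : count id (first_row s) = p by apply/eqP; rewrite eqn_leq cp.
split; first exact/eqP.
apply/negP; move E: (first_row s) => w; case/lastP: w E => [E|w b E].
  by move: cp'; rewrite E /=; lia.
rewrite last_rcons => b1; rewrite {b}b1 in E.
have szw : size w < n.+1 by have := size_first_row s; rewrite E size_rcons; lia.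
have := H (Ordinal szw); rewrite extE E /= -cats1 take_size_cat // drop_size_cat //.
by move: cp'; rewrite E -cats1 count_cat /=; lia.
Qed.

(** * Ballot words *)

(** The number [h] is the initial surplus of [true]s; each [false] consumes one
    unit of it. *)
Fixpoint ballot (h : nat) (w : bitseq) : bool :=
  match w with
  | [::] => true
  | true :: w' => ballot h.+1 w'
  | false :: w' => (0 < h) && ballot h.-1 w'
  end.

Lemma ballot_cat h u v :
  ballot h (u ++ v) =
  ballot h u && ballot (h + count id u - count negb u) v.
Proof.
elim: u h => [|[] u IH] h /=; first by rewrite addn0 subn0.
  by rewrite IH addSn addnS.
by case: h => [|h] //=; rewrite IH add0n add1n addSn subSS.
Qed.

Lemma ballot_runs h a b : ballot h (nseq a false ++ nseq b true) = (a <= h).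
Proof.
elim: a h => [|a IH] h; last by case: h => [|h] //=; rewrite IH.
by rewrite leq0n; elim: b h => //= b IH h; apply: IH.
Qed.

Lemma ballot_run h a : ballot h (nseq a false) = (a <= h).
Proof. by rewrite -(ballot_runs h a 0) cats0. Qed.

Lemma ballot_true h w : ballot h (true :: w) = ballot h.+1 w.
Proof. by []. Qed.

Lemma count_bool (w : bitseq) : count id w + count negb w = size w.
Proof. exact: (count_predC id). Qed.

(** The two ways of inserting: at the end of the first row, or by bumping a
    value to the end of the second row. Read backwards, the first one takes a
    cell off the first row and the second one a cell off the second row. *)
Lemma insert_fibre t w : t <= size w -> two_runs (drop t w) ->
  exists u a, size u = t /\
   ((w = u ++ nseq a false /\ row_insert t w = u ++ true :: nseq a false) \/
    exists b, w = u ++ nseq a false ++ nseq b.+1 true /\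
      row_insert t w = u ++ true :: nseq a.+1 false ++ nseq b true).
Proof.
case/cut_at=> u [v [-> <-]]; rewrite drop_size_cat // insert_cat => /two_runsP[a [b ->]].
exists u, a; split=> //; rewrite bump_first_nseq; case: b => [|b]; [left|right].
  by rewrite !cats0 addn0.
by exists b; rewrite addn1.
Qed.

Lemma insert_run u a :
  row_insert (size u) (u ++ nseq a false) = u ++ true :: nseq a false.
Proof. by have := bump_first_nseq a 0; rewrite insert_cat !cats0 addn0 => ->. Qed.

Lemma insert_runs u a b :
  row_insert (size u) (u ++ nseq a false ++ nseq b.+1 true) =
  u ++ true :: nseq a.+1 false ++ nseq b true.
Proof. by rewrite insert_cat bump_first_nseq addn1. Qed.

Lemma ballot_first_row n (s : 'S_n) : av321 s -> ballot 0 (first_row s).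
Proof.
elim: n s => // n IH s; have [t [s0 ->]] := perm_extension s.
have tn : t <= size (first_row s0) by rewrite size_first_row -ltnS.
rewrite av321_ext first_row_ext => /andP[/IH b0 d0].
have [u [a [_ [[E ->]|[b [E ->]]]]]] := insert_fibre tn d0; move: b0; rewrite E 2!(ballot_cat _ u).
  by rewrite ballot_true !ballot_run => /andP[-> ?] /=; lia.
by rewrite ballot_true !ballot_runs => /andP[-> ?] /=; lia.
Qed.

(** A word is cut in at most one way at a [true] followed by a suffix in [Q], if
    no suffix in [Q] sits behind a [true] inside another one. *)
Lemma split_true_inj (Q : pred bitseq) u x v y :
  (forall z r, Q z -> ~~ Q (r ++ true :: z)) -> Q x -> Q y ->
  u ++ true :: x = v ++ true :: y -> u = v /\ x = y.
Proof.
move=> QQ Qx Qy; elim: u v => [|b u IH] [|c v] //= [].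
- by [].
- by move=> _ E; move: Qx; rewrite E (negbTE (QQ _ _ Qy)).
- by move=> _ E; move: Qy; rewrite -E (negbTE (QQ _ _ Qx)).
- by move=> -> /IH[-> ->].
Qed.

Lemma last_true w : 0 < count id w -> exists u a, w = u ++ true :: nseq a false.
Proof.
elim/last_ind: w => // w [] IH; first by exists w, 0; rewrite cats1.
rewrite -cats1 count_cat addn0 => /IH[u [a ->]]; exists u, (a + 1).
by rewrite nseqD -catA.
Qed.

Lemma ballot_count h w : ballot h w -> count negb w <= h + count id w.
Proof.
elim: w h => [|[] w IH] h //=; first by move=> /IH; lia.
by case/andP => ? /IH; lia.
Qed.

Lemma last_true_false w : ballot 0 w -> 0 < count negb w ->
  exists u a b, w = u ++ true :: nseq a.+1 false ++ nseq b true.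
Proof.
elim/last_ind: w => // w [] IH bw; rewrite -cats1 count_cat /=.
  move: bw; rewrite -cats1 ballot_cat !addn0 => /andP[bw _] cw.
  have [u [a [b ->]]] := IH bw cw.
  by exists u, a, (b + 1); rewrite nseqD -!(catA, cat_cons).
move=> _; have := ballot_count bw; rewrite -cats1 !count_cat /= => cw.
have [|u [a E]] := @last_true (w ++ [:: false]); first by rewrite count_cat /=; lia.
case: a E => [|a] E; first by have := congr1 (last true) E; rewrite !last_cat.
by exists u, a, 0; rewrite E cats0.
Qed.

(** * Standard tableaux with two rows *)

(** The number of standard Young tableaux of shape (p, q); the recurrence removes
    the cell with the largest entry. *)
Fixpoint syt2 (p : nat) : nat -> nat :=
  match p with
  | 0 => fun q => q == 0
  | p'.+1 => fix syt2p q :=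
      match q with
      | 0 => 1
      | q'.+1 => if q' <= p' then syt2p q' + syt2 p' q'.+1 else 0
      end
  end.

Lemma syt2_0 p : syt2 p 0 = 1.
Proof. by case: p. Qed.

Lemma syt2S p q :
  syt2 p.+1 q.+1 = if q <= p then syt2 p.+1 q + syt2 p q.+1 else 0.
Proof. by []. Qed.

Lemma syt2_gt p q : p < q -> syt2 p q = 0.
Proof. by case: p q => [|p] [|q] //; rewrite ltnS syt2S ltnNge => /negbTE->. Qed.

Lemma syt2_gt0 p q : q <= p -> 0 < syt2 p q.
Proof.
elim: p q => [|p IH] [|q] //; rewrite ltnS => qp; rewrite syt2S qp addn_gt0.
apply/orP; left; elim: q qp => [|q IHq] qp; first by rewrite syt2_0.
by rewrite syt2S (ltnW qp) addn_gt0 IHq // ltnW.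
Qed.

(** The hook length formula for the shape (p, q), which is the ballot theorem.
    Multiplying out keeps it in [nat]; both sides vanish for q > p. *)
Lemma syt2E p q : p.+1 * syt2 p q = (p.+1 - q) * 'C(p + q, q).
Proof.
elim: p q => [|p IHp]; first by case=> [|[|q]].
elim=> [|q IHq]; first by rewrite syt2_0 bin0 subn0.
rewrite syt2S; case: leqP => pq; last by rewrite (_ : p.+2 - q.+1 = 0); lia.
have H := IHp q.+1; have B := mul_bin_left (p + q.+1) q.
rewrite addSn binS -addSnnS; rewrite -addSnnS in H B; rewrite addSn in IHq H B *.
have [d E] : exists d, p = q + d by exists (p - q); lia.
move: H B IHq; move: (syt2 p.+1 q) (syt2 p q.+1) 'C(_, _) 'C(_, _) => X Y C1 C0 H B IHq.
rewrite (_ : p.+1 - q.+1 = d) in H; last by lia.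
rewrite (_ : (p + q).+1 - q = p.+1) in B; last by lia.
rewrite (_ : p.+2 - q = d.+2) in IHq; last by lia.
rewrite (_ : p.+2 - q.+1 = d.+1); last by lia.
subst p; nia.
Qed.

(** * Permutations with a given first row *)

Lemma no_true_cat z r : all negb z -> ~~ all negb (r ++ true :: z).
Proof. by rewrite all_cat /= andbF. Qed.

Lemma run_inj u v a b :
  u ++ true :: nseq a false = v ++ true :: nseq b false -> u = v /\ a = b.
Proof.
case/(split_true_inj no_true_cat); rewrite ?all_nseq ?orbT // => -> /(congr1 size).
by rewrite !size_nseq.
Qed.

(** In a word with a [true] directly followed by [false], the suffix behind the
    last such [true] is the only one behind a [true] with this property. *)
Definition false_runs w := ~~ head true w && two_runs w.

Lemma false_runs_cat z r : false_runs z -> ~~ false_runs (r ++ true :: z).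
Proof.
case: z => [|[] z] // /andP[_ z2]; case: r => // b r; rewrite /false_runs negb_and.
by apply/orP; right; apply/negP => /cat_sorted2[].
Qed.

Lemma runs_inj u v a b c d :
  u ++ true :: nseq a.+1 false ++ nseq b true =
  v ++ true :: nseq c.+1 false ++ nseq d true -> [/\ u = v, a = c & b = d].
Proof.
have Q e f : false_runs (nseq e.+1 false ++ nseq f true) by rewrite /false_runs two_runs_nseq.
case/(split_true_inj false_runs_cat (Q a b) (Q c d)) => -> E; split=> //.
  by have := congr1 (count negb) E; rewrite !count_cat !count_nseq /=; lia.
by have := congr1 (count id) E; rewrite !count_cat !count_nseq /=; lia.
Qed.

Definition num_av321_with_row n (w : bitseq) : nat :=
  #|[set s : 'S_n | av321 s && (first_row s == w)]|.

Lemma num_av321_with_row_nonballot n w : ~~ ballot 0 w -> num_av321_with_row n w = 0.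
Proof.
move=> bw; apply: eq_card0 => s; rewrite !inE; apply/negP => /andP[/ballot_first_row bs /eqP E].
by rewrite -E bs in bw.
Qed.

Lemma num_av321_with_rowS n w :
  num_av321_with_row n.+1 w =
  \sum_(t < n.+1) #|[set s : 'S_n | [&& av321 s, two_runs (drop t (first_row s)) &
                                        row_insert t (first_row s) == w]]|.
Proof.
rewrite /num_av321_with_row card_perm_recr; apply: eq_bigr => t _; apply: eq_card => s.
by rewrite !inE av321_ext first_row_ext andbA.
Qed.

Lemma sum_at n t (F : nat -> nat) : t <= n ->
  (forall i, i != t -> F i = 0) -> \sum_(i < n.+1) F i = F t.
Proof.
move=> tn F0; rewrite (bigD1 (inord t)) //= inordK // big1 ?addn0 // => i it.
by apply: F0; apply: contraNneq it => <-; rewrite inord_val.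
Qed.

(** With an empty second row, only the identity remains: there is just one
    corner to remove. *)
Lemma num_av321_with_row_trues n : num_av321_with_row n (nseq n true) = 1.
Proof.
elim: n => [|n IH].
  rewrite /num_av321_with_row (_ : [set s | _] = setT) ?cardsT ?card_Sn //.
  apply/setP => s; rewrite !inE andbT /av321 -contains_inc_complement contains_incE.
  by rewrite inc_below_nil.
rewrite num_av321_with_rowS.
pose F i := if i == n then num_av321_with_row n (nseq n true) else 0.
have -> : 1 = F n by rewrite /F eqxx IH.
rewrite -(@sum_at n n F (leqnn n)); last by move=> i /negbTE; rewrite /F => ->.
apply: eq_bigr => t _; rewrite /F.
have key (s : 'S_n) :
   two_runs (drop t (first_row s)) && (row_insert t (first_row s) == nseq n.+1 true) =
   (t == n :> nat) && (first_row s == nseq n true).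
  have tn : t <= size (first_row s) by rewrite size_first_row -ltnS.
  apply/andP/andP => [[d0 /eqP]|[/eqP-> /eqP->]]; last first.
    have := insert_run (nseq n true) 0; rewrite size_nseq cats0 -(nseqD n 1) addn1 => ->.
    by rewrite -[X in drop X](size_nseq n true) drop_size.
  have [u [a [<- [[-> ->]|[b [-> ->]]]]]] := insert_fibre tn d0 => E.
    have a0 : a = 0 by have := congr1 (count negb) E; rewrite count_cat /= !count_nseq; lia.
    move: E; rewrite a0 cats1 cats0 -addn1 nseqD cats1 => /rcons_inj[->].
    by rewrite size_nseq.
  by have := congr1 (count negb) E; rewrite count_cat /= count_cat !count_nseq; lia.
case: eqP => tn; last first.
  apply: eq_card0 => s; rewrite !inE key; case: eqP tn => // _ _; rewrite andbF //.
by apply: eq_card => s; rewrite !inE key tn eqxx.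
Qed.

(** The last entry and the word before it was appended are determined by the
    corner that the last insertion has created: [u1] and [a1] come from the last
    [true] of [w], and [u2], [a2], [b2] from its last [true] directly followed
    by [false]. *)
Lemma num_av321_with_row_rec n u1 a1 u2 a2 b2 :
  let w := u1 ++ true :: nseq a1 false in
  w = u2 ++ true :: nseq a2.+1 false ++ nseq b2 true -> size w = n.+1 ->
  num_av321_with_row n.+1 w = num_av321_with_row n (u1 ++ nseq a1 false) +
    num_av321_with_row n (u2 ++ nseq a2 false ++ nseq b2.+1 true).
Proof.
move=> w E sw; set w1 := u1 ++ _; set w2 := u2 ++ nseq _ _ ++ _.
(* The two predecessors differ in their number of [true]s, so the two cases are
   disjoint even when they share the last entry. *)
have n12 : w1 != w2.
  apply/eqP => /(congr1 (count id)); move/(congr1 (count id)): E.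
  by rewrite /w !(count_cat, count_nseq) /= !(count_cat, count_nseq) /=; lia.
have s1 : size u1 <= n by move: sw; rewrite /w size_cat /=; lia.
have s2 : size u2 <= n by move: sw; rewrite E size_cat /=; lia.
pose F (u v : bitseq) i := if i == size u then num_av321_with_row n v else 0.
have F0 u v i : i != size u -> F u v i = 0 by rewrite /F => /negbTE->.
have FE u v : num_av321_with_row n v = F u v (size u) by rewrite /F eqxx.
rewrite (FE u1) (FE u2) -(sum_at s1 (F0 _ _)) -(sum_at s2 (F0 _ _)).
rewrite -big_split num_av321_with_rowS; apply: eq_bigr => t _ /=; rewrite /F.
have key (s : 'S_n) : two_runs (drop t (first_row s)) && (row_insert t (first_row s) == w) =
   (t == size u1 :> nat) && (first_row s == w1) || (t == size u2 :> nat) && (first_row s == w2).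
  have tn : t <= size (first_row s) by rewrite size_first_row -ltnS.
  apply/andP/orP => [[d0 /eqP]|].
    have [u [a [<- [[-> ->]|[b [-> ->]]]]]] := insert_fibre tn d0.
      by case/run_inj => -> ->; left; rewrite !eqxx.
    by rewrite E => /runs_inj[-> -> ->]; right; rewrite !eqxx.
  case=> /andP[/eqP-> /eqP->].
    rewrite insert_run eqxx drop_size_cat //.
    by rewrite -[nseq _ _]cats0 (two_runs_nseq _ 0).
  by rewrite insert_runs -E eqxx drop_size_cat // two_runs_nseq.
transitivity (#|[set s : 'S_n | [&& av321 s, t == size u1 :> nat & first_row s == w1]]| +
  #|[set s : 'S_n | [&& av321 s, t == size u2 :> nat & first_row s == w2]]|).
  rewrite -cardsUI (_ : _ :&: _ = set0) ?cards0 ?addn0.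
    by apply: eq_card => s; rewrite !inE key andb_orr.
  apply/setP => s; rewrite !inE; apply/negP => /andP[/and3P[_ _ /eqP E1] /and3P[_ _ /eqP E2]].
  by move/eqP: n12; apply; rewrite -E1 -E2.
congr (_ + _); case: eqP => _.
- by apply: eq_card => s; rewrite !inE.
- by apply: eq_card0 => s; rewrite !inE andbF.
- by apply: eq_card => s; rewrite !inE.
- by apply: eq_card0 => s; rewrite !inE andbF.
Qed.

(** Removing a cell of the second row always leaves a ballot word, while removing
    one of the first row leaves a ballot word iff p > q; otherwise no permutation
    has that word, in accordance with [syt2_gt]. *)
Lemma num_av321_with_rowE n w : size w = n -> ballot 0 w ->
  num_av321_with_row n w = syt2 (count id w) (count negb w).
Proof.
elim: n w => [|n IH] w sw bw.
  by move/size0nil: sw => ->; rewrite (num_av321_with_row_trues 0).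
case: (posnP (count negb w)) => [q0|q0].
  have E : w = nseq n.+1 true.
    rewrite -sw; apply/all_pred1P; rewrite (eq_all (a2 := id)); last by case.
    by rewrite all_count -[size w]count_bool q0 addn0.
  by rewrite q0 E num_av321_with_row_trues syt2_0.
have [|u1 [a1 E1]] := @last_true w; first by have := ballot_count bw; lia.
have [u2 [a2 [b2 E2]]] := last_true_false bw q0.
have := bw; rewrite {1}E1 ballot_cat ballot_true ballot_run => /andP[bu1 h1].
have := bw; rewrite {1}E2 ballot_cat ballot_true ballot_runs => /andP[bu2 h2].
have cp1 : count id w = (count id u1).+1 by rewrite E1 count_cat /= count_nseq; lia.
have cq1 : count negb w = count negb u1 + a1 by rewrite E1 count_cat /= count_nseq; lia.
have cp2 : count id w = count id u2 + b2.+1.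
  by rewrite E2 count_cat /= count_cat !count_nseq /=; lia.
have cq2 : count negb w = (count negb u2 + a2).+1.
  by rewrite E2 count_cat /= count_cat !count_nseq /=; lia.
have := count_bool w; rewrite sw => cw.
have := @num_av321_with_row_rec n u1 a1 u2 a2 b2; rewrite -E1.
move=> H; rewrite {}H // addnC.
rewrite cp1 cq2 syt2S; case: leqP => [qp|]; last by have := ballot_count bw; lia.
congr (_ + _).
  rewrite IH.
  - by congr syt2; rewrite !count_cat !count_nseq /=; lia.
  - by rewrite !size_cat !size_nseq; have := count_bool u2; lia.
  - by rewrite ballot_cat bu2 ballot_runs; lia.
have cu : count id u1 = count id (u1 ++ nseq a1 false) by rewrite count_cat count_nseq; lia.
have cv : (count negb u2 + a2).+1 = count negb (u1 ++ nseq a1 false).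
  by rewrite count_cat count_nseq /=; lia.
case: (boolP (ballot 0 (u1 ++ nseq a1 false))) => b1.
  rewrite IH //; first by rewrite cu cv.
  by rewrite size_cat size_nseq; have := count_bool u1; lia.
rewrite num_av321_with_row_nonballot // syt2_gt //.
by move: b1; rewrite ballot_cat bu1 ballot_run /=; lia.
Qed.

(** * Counting crucial permutations *)

Lemma card_tuple_rcons n (P : pred bitseq) :
  #|[set w : n.+1.-tuple bool | P w]| =
  #|[set w : n.-tuple bool | P (rcons w true)]| +
  #|[set w : n.-tuple bool | P (rcons w false)]|.
Proof.
have fB : bijective (fun bw : bool * n.-tuple bool => [tuple of rcons bw.2 bw.1]).
  apply: inj_card_bij; last by rewrite card_prod !card_tuple card_bool expnS.
  by move=> [b w] [c v] /(congr1 val)/= /rcons_inj[/val_inj -> ->].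
transitivity (\sum_(b : bool) #|[set w : n.-tuple bool | P (rcons w b)]|).
  under eq_bigr do rewrite -sum1dep_card.
  by rewrite -sum1dep_card pair_big_dep /= (reindex _ (onW_bij _ fB)).
by rewrite big_bool.
Qed.

Lemma card_ballot n p q : n = p + q ->
  #|[set w : n.-tuple bool | ballot 0 w && (count id w == p)]| = syt2 p q.
Proof.
elim: n p q => [|n IH] p q E.
  have [-> ->] : p = 0 /\ q = 0 by lia.
  rewrite (_ : [set w | _] = setT) ?cardsT ?card_tuple //.
  by apply/setP => w; rewrite !inE tuple0.
rewrite (card_tuple_rcons _ (fun w => ballot 0 w && (count id w == p))).
have -> : #|[set w : n.-tuple bool | ballot 0 (rcons w true) && (count id (rcons w true) == p)]| =
    if p is p'.+1 then syt2 p' q else 0.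
  case: p E => [|p] E.
    by apply: eq_card0 => w; rewrite !inE -cats1 count_cat /= addn1 andbF.
  rewrite -IH; last by lia.
  apply: eq_card => w; rewrite !inE -cats1 ballot_cat count_cat /= andbT.
  by rewrite addn1 eqSS.
have -> : #|[set w : n.-tuple bool | ballot 0 (rcons w false) && (count id (rcons w false) == p)]| =
    if (0 < q) && (q <= p) then syt2 p q.-1 else 0.
  have sub (w : n.-tuple bool) :
     ballot 0 (rcons w false) && (count id (rcons w false) == p) =
     [&& 0 < q, q <= p & ballot 0 w && (count id w == p)].
    rewrite -cats1 ballot_cat count_cat /= !addn0 andbT add0n subn_gt0.
    have := count_bool w; rewrite size_tuple; case: eqP => [->|_]; last by rewrite !andbF.
    by rewrite !andbT; case: (ballot 0 w) => /=; lia.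
  case: ifP => [/andP[q0 qp]|qF].
    rewrite -IH; last by lia.
    by apply: eq_card => w; rewrite !inE sub q0 qp.
  by apply: eq_card0 => w; rewrite !inE sub andbA qF.
case: p q E => [|p] [|q] E //; first by rewrite syt2_0 addn0.
rewrite syt2S /= ltnS addnC; case: leqP => // pq.
by rewrite syt2_gt // ltnW.
Qed.

(** Group the crucial permutations by their word. Each word contributes
    [syt2 p (m.+1 - p)]; deleting its final [false] makes it an arbitrary ballot
    word with [p] letters [true] and fewer than [p] letters [false]. Without the
    strict inequality there is no such word, and the second factor vanishes. *)
Lemma num_right_crucial_syt2 m p : 0 < p -> p <= m ->
  num_right_crucial m.+1 p.+1 3 = syt2 p (m - p) * syt2 p (m.+1 - p).
Proof.
move=> p0 pm; rewrite /num_right_crucial -sum1dep_card.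
pose W (s : 'S_m.+1) : m.+1.-tuple bool := Tuple (introT eqP (size_first_row s)).
rewrite (partition_big W (fun w => [&& ballot 0 w, count id w == p & ~~ last true w])) /=.
  rewrite (eq_bigr (fun _ => syt2 p (m.+1 - p))) => [|w /and3P[bw /eqP cw lw]].
    rewrite sum_nat_cond_const; case: (ltnP (m - p) p) => mp; last first.
      by rewrite (@syt2_gt p (m.+1 - p)) ?muln0 //; lia.
    congr (_ * _).
    rewrite (card_tuple_rcons _ (fun w => [&& ballot 0 w, count id w == p & ~~ last true w])).
    rewrite eq_card0 ?add0n; last by move=> w; rewrite !inE last_rcons !andbF.
    have sub (w : m.-tuple bool) :
       [&& ballot 0 (rcons w false), count id (rcons w false) == p & ~~ last true (rcons w false)] =
       (m - p < p) && (ballot 0 w && (count id w == p)).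
      rewrite -cats1 ballot_cat count_cat last_cat /= !addn0 !andbT add0n subn_gt0.
      have := count_bool w; rewrite size_tuple; case: eqP => [->|_]; last by rewrite !andbF.
      by rewrite !andbT; case: (ballot 0 w) => /=; lia.
    rewrite -(@card_ballot m); last by lia.
    by apply: eq_card => w; rewrite !inE sub mp.
  rewrite sum1dep_card -cw; have -> : m.+1 - count id w = count negb w.
    by have := count_bool w; rewrite size_tuple; lia.
  rewrite -(@num_av321_with_rowE m.+1) ?size_tuple //; apply: eq_card => s.
  rewrite !inE right_crucialE ?cw //.
  have -> : (W s == w) = (first_row s == w) by [].
  by case: (first_row s =P w) => [->|]; rewrite ?andbF // cw eqxx lw !andbT.
move=> s; rewrite right_crucialE // => /and3P[s3 cs ls].
by rewrite -/(first_row s) (ballot_first_row s3) cs ls.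
Qed.

(** A word of length at most [p] with [p] letters [true] ends with [true]. *)
Lemma num_right_crucial_short n p : 0 < p -> n <= p -> num_right_crucial n p.+1 3 = 0.
Proof.
move=> p0 np; apply: eq_card0 => s; rewrite !inE right_crucialE //.
apply/negP => /and3P[_ /eqP cs]; have := count_bool (first_row s).
rewrite size_first_row cs => E.
have {E} : all id (first_row s) by rewrite all_count size_first_row cs; lia.
by elim/last_ind: (first_row s) => // w b _; rewrite all_rcons last_rcons => /andP[->].
Qed.

Lemma num_right_crucialS k q : 2 <= k ->
  num_right_crucial (k + q) k 3 = syt2 k.-1 q * syt2 k.-1 q.+1.
Proof.
case: k => [|p] // p0; rewrite addSn num_right_crucial_syt2 //; last by lia.
by congr (syt2 _ _ * syt2 _ _); lia.
Qed.

Lemma num_right_crucial1 n : 0 < n -> num_right_crucial n 1 3 = 0.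
Proof.
move=> n0; apply: eq_card0 => s; rewrite !inE /right_crucial.
by rewrite contains_incE inc_below1 // n0.
Qed.

Lemma num_right_crucial_diag k : 1 <= k -> num_right_crucial k k 3 = k - 1.
Proof.
case: (ltngtP k 1) => [|k1|->] // _; last by rewrite num_right_crucial1.
rewrite -[X in num_right_crucial X]addn0 num_right_crucialS // syt2_0 mul1n.
have := syt2E k.-1 1; rewrite prednK; last by lia.
by rewrite addn1 bin1 prednK; [nia | lia].
Qed.

Lemma num_right_crucial_gt0 k q : 2 <= k -> (0 < num_right_crucial (k + q) k 3) = (q.+1 < k).
Proof.
case: k => // p p1; rewrite num_right_crucialS // muln_gt0 /= ltnS.
case: (leqP q.+1 p) => qp; first by rewrite !syt2_gt0 // ltnW.
by rewrite (@syt2_gt p q.+1) // andbF.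
Qed.

(** The lengths of (k, 3)-crucial permutations are k, ..., 2k - 2. *)
Lemma ith_smallest_length_crucial k i : 2 <= i -> i < k -> ith_smallest_length k 3 i (k + i - 1).
Proof.
move=> i2 ik; rewrite /ith_smallest_length.
have -> : k + i - 1 = k + i.-1 by lia.
have k2 : 2 <= k by lia.
rewrite num_right_crucial_gt0 // prednK; last by lia.
split=> //; rewrite iotaD count_cat -[RHS]prednK; last by lia.
congr _.+1; rewrite (eq_in_count (a2 := pred0)) ?count_pred0 => [|m]; last first.
  by rewrite mem_iota /= add0n => mk; rewrite -(prednK (ltnW k2)) num_right_crucial_short; lia.
rewrite (eq_in_count (a2 := predT)) ?count_predT ?size_iota // => m.
rewrite mem_iota add0n => /andP[km mi]; rewrite -(subnKC km) num_right_crucial_gt0 //=; lia.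
Qed.

Lemma num_right_crucial_long k i : 1 <= k -> k <= i -> num_right_crucial (k + i - 1) k 3 = 0.
Proof.
case: (ltngtP k 1) => [|k1|->] // _ ki; last by rewrite num_right_crucial1 //; lia.
apply/eqP; rewrite -leqn0 leqNgt (_ : k + i - 1 = k + i.-1); last by lia.
by rewrite num_right_crucial_gt0 // prednK //; lia.
Qed.

(** * The formulas *)

Local Open Scope ring_scope.

Lemma syt2_rat p q : (q <= p.+1)%N ->
  (syt2 p q)%:R = (p.+1%:R - q%:R) / p.+1%:R * 'C(p + q, q)%:R :> rat.
Proof.
move=> qp; have p0 : p.+1%:R != 0 :> rat by rewrite Num.Theory.pnatr_eq0.
apply: (mulfI p0); rewrite -natrM syt2E natrM natrB //; field.
by rewrite nat1r.
Qed.

Lemma num_right_crucial_rat k n : (3 <= k)%N -> (k + 1 <= n)%N -> (n <= 2 * k)%N ->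
  (num_right_crucial n k 3)%:R =
    ((2%:R * k%:R - n%:R) * (2%:R * k%:R - n%:R - 1)) /
    ((n%:R - k%:R) * (n%:R - k%:R + 1)) *
    'C(n - 1, k)%:R * 'C(n, k)%:R :> rat.
Proof.
move=> k3 kn n2k; have [q E] : exists q, n = (k + q.+1)%N by exists (n - k).-1; lia.
subst n; rewrite num_right_crucialS; last by lia.
have [kq|qk] := leqP k q.+1.
  (* For n = 2k both sides vanish. *)
  have -> : q.+1 = k by lia.
  rewrite (@syt2_gt k.-1 k.+1) ?muln0; last by lia.
  rewrite (_ : 2%:R * k%:R - (k + k)%:R = 0 :> rat) ?mul0r ?mul0r //.
  by rewrite (natrD _ k k); ring.
case: k k3 kn n2k qk => // p p2 _ _ qp.
have neq0 m : m.+1%:R != 0 :> rat by rewrite Num.Theory.pnatr_eq0.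
(* Both binomials of the hook length formula are re-indexed to lower index k. *)
have binE m : 'C(p + m.+1, m.+1)%:R = p.+1%:R / m.+1%:R * 'C(p + m.+1, p.+1)%:R :> rat.
  apply: (mulfI (neq0 m)); rewrite mulrA mulrCA divff // mulr1 -!natrM.
  by rewrite (mul_bin_left _ p) addKn -(bin_sub (leq_addr m.+1 p)) addKn.
rewrite natrM !syt2_rat //=; [|lia..].
rewrite !binE (_ : p.+1 + q.+1 - 1 = p + q.+1)%N; last by lia.
rewrite (_ : p.+1 + q.+1 = p + q.+2)%N; last by lia.
move: ('C(_, _)%:R) ('C(_, _)%:R) => c1 c2.
field; rewrite ?nat1r ?natr1 //.
rewrite neq0 (_ : p%:R + (2 + q%:R) - p.+1%:R + 1 = q.+2%:R); last by ring.
by rewrite (_ : p%:R + (2 + q%:R) - p.+1%:R = q.+1%:R) ?neq0 //; ring.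
Qed.

Lemma num_right_crucial_nth_rat k i : (2 <= i)%N -> (i <= k - 1)%N ->
  (num_right_crucial (k + i - 1) k 3)%:R =
    ((k%:R - i%:R) * (k%:R - i%:R + 1)) / (i%:R * (i%:R - 1)) *
    'C(k + i - 2, k)%:R * 'C(k + i - 1, k)%:R :> rat.
Proof.
move=> i2 ik; rewrite num_right_crucial_rat; [|lia..].
rewrite (_ : k + i - 1 - 1 = k + i - 2)%N; last by lia.
have -> : (k + i - 1)%:R = k%:R + i%:R - 1 :> rat by rewrite natrB ?natrD; last by lia.
have -> : 2%:R * k%:R - (k%:R + i%:R - 1) = k%:R - i%:R + 1 :> rat by ring.
have -> : k%:R + i%:R - 1 - k%:R = i%:R - 1 :> rat by ring.
by rewrite addrK subrK [X in X / _]mulrC [X in _ / X]mulrC.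
Qed.

Theorem corollary13 :
  [/\ (forall k : nat, (1 <= k)%N -> num_right_crucial k k 3 = (k - 1)%N),
      (forall k n : nat, (3 <= k)%N -> (k + 1 <= n)%N -> (n <= 2 * k)%N ->
        (num_right_crucial n k 3)%:R =
          ((2%:R * k%:R - n%:R) * (2%:R * k%:R - n%:R - 1)) /
          ((n%:R - k%:R) * (n%:R - k%:R + 1)) *
          'C(n - 1, k)%:R * 'C(n, k)%:R :> rat),
      (forall k i : nat, (2 <= i)%N -> (i <= k - 1)%N ->
        ith_smallest_length k 3 i (k + i - 1) /\
        (num_right_crucial (k + i - 1) k 3)%:R =
          ((k%:R - i%:R) * (k%:R - i%:R + 1)) / (i%:R * (i%:R - 1)) *
          'C(k + i - 2, k)%:R * 'C(k + i - 1, k)%:R :> rat) &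
      (forall k i : nat, (1 <= k)%N -> (k <= i)%N ->
        num_right_crucial (k + i - 1) k 3 = 0%N)]
  /\
  (forall l : nat, (3 <= l)%N ->
   [/\ num_right_crucial l 3 l = (l - 1)%N,
       (forall n : nat, (l + 1 <= n)%N -> (n <= 2 * l)%N ->
         (num_right_crucial n 3 l)%:R =
           ((2%:R * l%:R - n%:R) * (2%:R * l%:R - n%:R - 1)) /
           ((n%:R - l%:R) * (n%:R - l%:R + 1)) *
           'C(n - 1, l)%:R * 'C(n, l)%:R :> rat),
       (forall i : nat, (2 <= i)%N -> (i <= l - 1)%N ->
         ith_smallest_length 3 l i (l + i - 1) /\
         (num_right_crucial (l + i - 1) 3 l)%:R =
           ((l%:R - i%:R) * (l%:R - i%:R + 1)) / (i%:R * (i%:R - 1)) *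
           'C(l + i - 2, l)%:R * 'C(l + i - 1, l)%:R :> rat) &
       (forall i : nat, (l <= i)%N -> num_right_crucial (l + i - 1) 3 l = 0%N)]).
Proof.
have ith k i : (2 <= i)%N -> (i <= k - 1)%N -> ith_smallest_length k 3 i (k + i - 1).
  by move=> i2 ik; apply: ith_smallest_length_crucial; lia.
split.
  split; [exact: num_right_crucial_diag | exact: num_right_crucial_rat | | ].
    by move=> k i i2 ik; split; [exact: ith | exact: num_right_crucial_nth_rat].
  exact: num_right_crucial_long.
move=> l l3; split=> [|n ln n2l|i i2 il|i li].
- by rewrite num_right_crucialC num_right_crucial_diag //; lia.
- by rewrite num_right_crucialC num_right_crucial_rat.
- split; last by rewrite num_right_crucialC num_right_crucial_nth_rat.
  have [gt0 cnt] := ith l i i2 il; split; first by rewrite num_right_crucialC.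
  by rewrite -[RHS]cnt; congr _.+1; apply: eq_count => m; rewrite num_right_crucialC.
- by rewrite num_right_crucialC num_right_crucial_long //; lia.
Qed.
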